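(* Let $\Omega\subseteq\mathcal A^d$ be an NC domain containing a scalar point $a$, and let $F:\Omega\to B(\mathcal H)$ be an NC function. Then for each integer $k\ge 1$, the $k$-th derivative $D^kF(a)[h_1,\dots,h_k]$ is, as a function of $h_1,\dots,h_k\in\mathcal A^d$, a symmetric homogeneous free polynomial of degree $k$ in $h_1,\dots,h_k$.
   Context: Throughout, $\mathcal H$ is an infinite-dimensional complex Hilbert space, $\mathcal H^{(n)}=\oplus_{j=1}^n\mathcal H$, and $\mathcal A\subseteq B(\mathcal H)$ is a unital norm-closed subalgebra with the direct sum property: for every $n\ge1$ there is a unitary $U_n:\mathcal H^{(n)}\to\mathcal H$ with $U_n\,\mathcal T_n(\mathcal A)\,U_n^*\subseteq\mathcal A$, where $\mathcal T_n(\mathcal A)$ is the set of upper triangular $n\times n$ matrices with entries in $\mathcal A$. Fix a positive integer $d$; $d$-tuples are written $x=(x^1,\dots,x^d)$, $\mathcal A^d$ carries the relative norm topology, and products, direct sums, conjugations etc. of $d$-tuples with operators are taken coordinatewise. NC domain: a set $\Omega\subseteq\mathcal A^d$ that is open, bounded, and closed under finite direct sums: for each $n\ge2$, with the unitary $U_n:\mathcal H^{(n)}\to\mathcal H$ (the same one as in the direct sum property of $\mathcal A$), $U_n(x_1\oplus\cdots\oplus x_n)U_n^*\in\Omega$ whenever $x_1,\dots,x_n\in\Omega$. NC function: $F:\Omega\to B(\mathcal H)$ that is locally bounded on $\Omega$ and intertwining preserving, i.e. whenever $x,y\in\Omega$ and $L\in B(\mathcal H)$ satisfy $Lx^r=y^rL$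 for $1\le r\le d$, then $LF(x)=F(y)L$. A scalar point is a $d$-tuple each of whose components is a scalar multiple of the identity. Derivatives are defined inductively by $D^0F=F$ and $D^kF(x)[h_1,\dots,h_k]=\lim_{\lambda\to0}\frac1\lambda\big(D^{k-1}F(x+\lambda h_k)[h_1,\dots,h_{k-1}]-D^{k-1}F(x)[h_1,\dots,h_{k-1}]\big)$, with $\lambda\in\mathbb C$ and limit in norm (NC functions are Fréchet holomorphic, so these exist). A free polynomial is a polynomial with complex coefficients in non-commuting variables; here the variables are the $dk$ coordinates $h_i^r$. Symmetric means invariant under all permutations of $h_1,\dots,h_k$. *)

(* Defs.v *)
From HB Require Import structures.
From mathcomp Require Import all_boot all_order all_algebra all_fingroup.
From mathcomp Require Import finmap sesquilinear complex.
(* The notations of [monalg] cannot be parsed together with those of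
   MathComp-Analysis. *)
From mathcomp Require Import -(notations) monalg.
From mathcomp Require Import all_classical all_reals all_analysis.

Set Implicit Arguments.
Unset Strict Implicit.
Unset Printing Implicit Defensive.

Import Order.TTheory GRing.Theory Num.Theory.
Import numFieldNormedType.Exports.

Local Open Scope classical_set_scope.
Local Open Scope complex_scope.
Local Open Scope ring_scope.

(* The inner product is linear in its first argument. *)
HB.mixin Record CompleteNormedModule_isHilbert (R : realType) V
    & CompleteNormedModule R[i] V := {
  inner : {dot V for @Num.conj R[i]};
  inner_norm : forall x : V, `|x| ^+ 2 = inner x x
}.

#[short(type="hilbertType")]
HB.structure Definition Hilbert (R : realType) :=
  {V of CompleteNormedModule R[i] V & CompleteNormedModule_isHilbert R V}.

Definition infinite_dimensional (R : realType) (H : hilbertType R) : Prop :=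
  forall (n : nat) (e : 'I_n -> H),
    exists x : H, forall c : 'I_n -> R[i], x <> \sum_i c i *: e i.

Section BoundedOperators.
Variables (R : realType) (H : hilbertType R).
Local Notation C := R[i].
Implicit Types (f g : H -> H).

Definition bounded_linear : {pred H -> H} := fun f =>
  `[< linear f /\ exists M : C, forall x, `|f x| <= M * `|x| >].

Lemma bounded_linearP f :
  reflect (linear f /\ exists M : C, forall x, `|f x| <= M * `|x|)
          (f \in bounded_linear).
Proof. exact: asboolP. Qed.

Fact bounded_linear_submod : submod_closed bounded_linear.
Proof.
split.
  apply/bounded_linearP; split; first by move=> a x y; rewrite scaler0 addr0.
  by exists 0 => x; rewrite mul0r normr0.
move=> a f g /bounded_linearP[lf [M fM]] /bounded_linearP[lg [N gN]].
apply/bounded_linearP; split.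
  move=> b x y /=; rewrite !fctE lf lg.
  rewrite !scalerDr !scalerA [a * b]mulrC.
  by rewrite -!addrA; congr (_ + _); rewrite addrCA.
exists (`|a| * M + N) => x; rewrite !fctE.
rewrite (le_trans (ler_normD _ _))// normrZ mulrDl -mulrA.
by rewrite lerD// ler_wpM2l.
Qed.

HB.instance Definition _ :=
  GRing.isSubmodClosed.Build C (H -> H) bounded_linear bounded_linear_submod.

Record bop : predArgType :=
  Bop { bop_fun :> H -> H ; _ : bop_fun \in bounded_linear }.

HB.instance Definition _ := [isSub for bop_fun].
HB.instance Definition _ := [Choice of bop by <:].
HB.instance Definition _ := [SubChoice_isSubLmodule of bop by <:].

Implicit Types (S T : bop).

Lemma bopP S T : S =1 T -> S = T.
Proof. by move=> ST; apply/val_inj/funext. Qed.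

Lemma bop_linear T : linear T.
Proof. by case: T => f /= /bounded_linearP[]. Qed.

HB.instance Definition _ T := GRing.isLinear.Build C H H _ T (bop_linear T).

Lemma bop_bounded T : exists M : C, 0 <= M /\ forall x, `|T x| <= M * `|x|.
Proof.
case: T => f /= /bounded_linearP[_ [M fM]].
exists `|M|; split=> // x; apply: le_trans (fM x) _.
have [->|x0] := eqVneq x 0; first by rewrite normr0 !mulr0.
have xp : 0 < `|x| by rewrite normr_gt0.
rewrite ler_pM2r//; apply: real_ler_norm.
have := le_trans (normr_ge0 _) (fM x).
by rewrite pmulr_lge0// => /ger0_real.
Qed.

Lemma bop0E x : (0 : bop) x = 0. Proof. by []. Qed.
Lemma bopDE S T x : (S + T) x = S x + T x. Proof. by []. Qed.
Lemma bopNE T x : (- T) x = - T x. Proof. by []. Qed.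
Lemma bopZE (a : C) T x : (a *: T) x = a *: T x. Proof. by []. Qed.

Fact bop_one_subproof : id \in bounded_linear.
Proof. by apply/bounded_linearP; split=> //; exists 1 => x; rewrite mul1r. Qed.
Definition bop_one := Bop bop_one_subproof.

Fact bop_mul_subproof S T : S \o T \in bounded_linear.
Proof.
apply/bounded_linearP; split; first by move=> a x y; rewrite /= !linearP.
have [M [M0 SM]] := bop_bounded S; have [N [N0 TN]] := bop_bounded T.
by exists (M * N) => x /=; rewrite (le_trans (SM _))// -mulrA ler_wpM2l.
Qed.
Definition bop_mul S T := Bop (bop_mul_subproof S T).

Fact bop_mulA : associative bop_mul. Proof. by move=> S T U; apply: bopP. Qed.
Fact bop_mul1l : left_id bop_one bop_mul. Proof. by move=> T; apply: bopP. Qed.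
Fact bop_mul1r : right_id bop_one bop_mul. Proof. by move=> T; apply: bopP. Qed.
Fact bop_mulDl : left_distributive bop_mul +%R.
Proof. by move=> S T U; apply: bopP. Qed.
Fact bop_mulDr : right_distributive bop_mul +%R.
Proof. by move=> S T U; apply: bopP => x; rewrite /= linearD. Qed.

HB.instance Definition _ := GRing.Zmodule_isPzRing.Build bop
  bop_mulA bop_mul1l bop_mul1r bop_mulDl bop_mulDr.

Lemma bop1E x : (1 : bop) x = x. Proof. by []. Qed.
Lemma bopME S T x : (S * T) x = S (T x). Proof. by []. Qed.

Lemma bop_scalerAl (a : C) S T : a *: (S * T) = a *: S * T.
Proof. by apply: bopP. Qed.

Lemma bop_scalerAr (a : C) S T : a *: (S * T) = S * (a *: T).
Proof. by apply: bopP => x; rewrite bopZE !bopME bopZE linearZ. Qed.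

Definition opnorm T : C :=
  (sup [set complex.Re `|T x| | x in [set x : H | `|x| <= 1]])%:C.

Let Re_normE x : (complex.Re `|x : H|)%:C = `|x|.
Proof. by rewrite RRe_real// normr_real. Qed.

Let opnorm_has_sup T :
  has_sup [set complex.Re `|T x| | x in [set x : H | `|x| <= 1]].
Proof.
split; first by exists (complex.Re `|T 0|), 0 => //=; rewrite normr0.
have [M [M0 TM]] := bop_bounded T; exists (complex.Re M) => _ [x /= x1 <-].
rewrite -lecR Re_normE RRe_real ?ger0_real//.
by rewrite (le_trans (TM x))// ler_piMr.
Qed.

Lemma opnorm_le T (M : C) :
  (forall x, `|x| <= 1 -> `|T x| <= M) -> opnorm T <= M.
Proof.
move=> TM; have M0 : 0 <= M by rewrite (le_trans _ (TM 0 _)) ?normr0.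
rewrite -[M]RRe_real ?ger0_real// lecR.
apply: ge_sup; first exact: (opnorm_has_sup T).1.
by move=> _ [x /= x1 <-]; rewrite -lecR Re_normE RRe_real ?ger0_real// TM.
Qed.

Lemma opnorm_ge0 T : 0 <= opnorm T.
Proof.
rewrite -[0]/(0%:C) lecR; apply: ub_le_sup; first exact: (opnorm_has_sup T).2.
by exists 0; rewrite /= ?normr0// linear0 normr0.
Qed.

Lemma opnormP T x : `|T x| <= opnorm T * `|x|.
Proof.
have [->|x0] := eqVneq x 0; first by rewrite linear0 !normr0 mulr0.
have xp : 0 < `|x| by rewrite normr_gt0.
have Tx1 : `|T (`|x|^-1 *: x)| <= opnorm T.
  rewrite -Re_normE lecR; apply: ub_le_sup; first exact: (opnorm_has_sup T).2.
  exists (`|x|^-1 *: x) => //=.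
  by rewrite normrZ ger0_norm ?invr_ge0// mulVf ?gt_eqF.
rewrite -ler_pdivrMr// mulrC; apply: le_trans Tx1.
by rewrite linearZ normrZ ger0_norm ?invr_ge0.
Qed.

Fact opnormD S T : opnorm (S + T) <= opnorm S + opnorm T.
Proof.
apply: opnorm_le => x x1; rewrite bopDE (le_trans (ler_normD _ _))//.
by rewrite lerD// (le_trans (opnormP _ _))// ler_piMr ?opnorm_ge0.
Qed.

Fact opnormZ (a : C) T : opnorm (a *: T) = `|a| * opnorm T.
Proof.
have le b U : opnorm (b *: U) <= `|b| * opnorm U.
  apply: opnorm_le => x x1; rewrite bopZE normrZ ler_wpM2l//.
  by rewrite (le_trans (opnormP _ _))// ler_piMr ?opnorm_ge0.
apply/eqP; rewrite eq_le le/=.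
have [->|a0] := eqVneq a 0; first by rewrite normr0 mul0r opnorm_ge0.
rewrite -ler_pdivlMl ?normr_gt0// -normfV.
by rewrite -[T in leLHS](scalerK a0) le.
Qed.

Fact opnorm0_eq0 T : opnorm T = 0 -> T = 0.
Proof.
move=> T0; apply: bopP => x; rewrite bop0E; apply/eqP; rewrite -normr_le0.
by rewrite (le_trans (opnormP _ _))// T0 mul0r.
Qed.

HB.instance Definition _ := Lmodule_isNormed.Build C bop
  opnormD opnormZ opnorm0_eq0.

Lemma bop_normE T : `|T| = opnorm T. Proof. by []. Qed.

End BoundedOperators.

Section DirectSums.
Variables (R : realType) (H : hilbertType R).
Local Notation C := R[i].

(* H^(n) is represented by ['I_n -> H], with the inner product
   \sum_i <f i, g i>. *)
Record unitary (n : nat) := Unitary {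
  unitary_fun :> ('I_n -> H) -> H;
  unitary_inv : H -> ('I_n -> H);
  unitary_linear : linear unitary_fun;
  unitary_funK : cancel unitary_fun unitary_inv;
  unitary_invK : cancel unitary_inv unitary_fun;
  unitary_inner : forall f g,
    inner (unitary_fun f) (unitary_fun g) = \sum_i inner (f i) (g i)
}.

Definition mxop n (T : 'M[bop H]_n) (f : 'I_n -> H) : 'I_n -> H :=
  fun i => \sum_j T i j (f j).

Section Conjugation.
Variables (n : nat) (U : unitary n) (T : 'M[bop H]_n).

Let U_linear := unitary_linear U.

Let sum_norm f : `|U f| ^+ 2 = \sum_i `|f i| ^+ 2.
Proof.
by rewrite inner_norm unitary_inner; apply: eq_bigr => i _; rewrite inner_norm.
Qed.

Let inv_norm y i : `|unitary_inv U y i| <= `|y|.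
Proof.
rewrite -(@ler_pXn2r _ 2)// ?nnegrE//.
rewrite -[in leRHS](unitary_invK U y) sum_norm (bigD1 i)//= lerDl.
by apply: sumr_ge0 => j _; rewrite exprn_ge0.
Qed.

Let fun_norm f : `|U f| <= \sum_i `|f i|.
Proof.
pose V : {linear ('I_n -> H) -> H} :=
  HB.pack (U : _ -> _) (GRing.isLinear.Build C ('I_n -> H) H _ U U_linear).
pose inj i v : 'I_n -> H := fun j => if j == i then v else 0.
have inj_norm i v : `|V (inj i v)| = `|v|.
  apply: (@pexpIrn _ 2) => //; rewrite ?nnegrE//.
  rewrite sum_norm (bigD1 i)//= big1 => [|j /negPf ji].
    by rewrite /inj eqxx addr0.
  by rewrite /inj ji normr0 expr0n.
have {1}-> : f = \sum_i inj i (f i).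
  apply/funext => j; rewrite fct_sumE (bigD1 j)//= big1 => [|i /negPf ij].
    by rewrite /inj eqxx addr0.
  by rewrite /inj eq_sym ij.
have -> : U (\sum_i inj i (f i)) = \sum_i V (inj i (f i)).
  by rewrite -linear_sum.
apply: le_trans (ler_norm_sum _ _ _) _.
by apply: ler_sum => i _; rewrite inj_norm.
Qed.

Fact unitary_conj_subproof :
  (U \o mxop T \o unitary_inv U) \in @bounded_linear R H.
Proof.
have inv_linear : linear (unitary_inv U).
  move=> a x y; apply: (can_inj (unitary_funK U)).
  by rewrite U_linear !unitary_invK.
apply/bounded_linearP; split.
  move=> a x y /=; rewrite inv_linear -U_linear; congr (U _).
  apply/funext => i; rewrite !fctE /mxop scaler_sumr -big_split/=.
  by apply: eq_bigr => j _; rewrite linearP.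
exists (\sum_i \sum_j `|T i j|) => y /=; rewrite (le_trans (fun_norm _))//.
rewrite mulr_suml; apply: ler_sum => i _.
rewrite mulr_suml (le_trans (ler_norm_sum _ _ _))//.
apply: ler_sum => j _; rewrite (le_trans (opnormP _ _))//.
by rewrite ler_wpM2l ?opnorm_ge0.
Qed.

Definition unitary_conj : bop H := Bop unitary_conj_subproof.

End Conjugation.
End DirectSums.

Section OperatorAlgebra.
Variables (R : realType) (H : hilbertType R).
Local Notation C := R[i].
Variables (A : set (bop H)) (U : forall n : nat, unitary H n.+1).

Record unital_closed_subalgebra : Prop := UnitalClosedSubalgebra {
  subalg_one : A 1;
  subalg_linear : forall (c : C) S T, A S -> A T -> A (c *: S + T);
  subalg_mul : forall S T, A S -> A T -> A (S * T);
  subalg_closed : closed A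
}.

(* [U n] is the unitary H^(n+1) -> H. *)
Definition direct_sum_property : Prop :=
  forall (n : nat) (T : 'M[bop H]_n.+1),
    (forall i j, A (T i j)) ->
    (forall i j : 'I_n.+1, (j < i)%N -> T i j = 0) ->
    A (unitary_conj (U n) T).

End OperatorAlgebra.

Notation op_tuple H d := ('I_d -> bop H).

Section NCFunctions.
Variables (R : realType) (H : hilbertType R) (d : nat).
Local Notation C := R[i].
(* The field of scalars with its norm topology. *)
Local Notation Ct := (R[i] : numFieldType).
Local Notation op_tuple := (op_tuple H d).

Definition tuples_in (A : set (bop H)) : set op_tuple :=
  [set x | forall r, A (x r)].

Definition scalar_point (x : op_tuple) : Prop :=
  exists c : 'I_d -> C, forall r, x r = c r *: (1 : bop H).

(* U (x_1 (+) ... (+) x_n) U^* *)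
Definition direct_sum n (U : unitary H n) (x : 'I_n -> op_tuple) : op_tuple :=
  fun r => unitary_conj U (diag_mx (\row_i x i r)).

(* Open means relatively open in A^d. *)
Record nc_domain (A : set (bop H)) (U : forall n : nat, unitary H n.+1)
    (Omega : set op_tuple) : Prop := NCDomain {
  nc_domain_sub : Omega `<=` tuples_in A;
  nc_domain_open : forall x, Omega x ->
    exists2 e : C, 0 < e & forall y, tuples_in A y ->
      (forall r, `|y r - x r| < e) -> Omega y;
  nc_domain_bounded : exists M : C, forall x, Omega x -> forall r, `|x r| <= M;
  nc_domain_direct_sum : forall (n : nat) (x : 'I_n.+2 -> op_tuple),
    (forall i, Omega (x i)) -> Omega (direct_sum (U n.+1) x)
}.

(* A function on Omega is represented by a function on all d-tuples, whose
   values outside Omega are irrelevant. *)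
Record nc_function (Omega : set op_tuple) (F : op_tuple -> bop H) : Prop :=
  NCFunction {
  nc_locally_bounded : forall x, Omega x ->
    exists2 e : C, 0 < e & exists M : C, forall y, Omega y ->
      (forall r, `|y r - x r| < e) -> `|F y| <= M;
  nc_intertwining : forall x y, Omega x -> Omega y -> forall L : bop H,
    (forall r, L * x r = y r * L) -> L * F x = F y * L
}.

Definition diff_quotient (G : op_tuple -> bop H) (x h : op_tuple) (l : C) :
    bop H :=
  l^-1 *: (G (x + l *: h) - G x).

(* [nc_derive F h x] is D^k F(x)[h_1, ..., h_k], with h_i = h (i - 1). *)
Fixpoint nc_derive (F : op_tuple -> bop H) (k : nat) :
    ('I_k -> op_tuple) -> op_tuple -> bop H :=
  match k with
  | 0 => fun _ => F
  | k'.+1 => fun h x =>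
      lim (diff_quotient (nc_derive F (h \o widen_ord (leqnSn k'))) x
             (h ord_max) l @[l --> (0 : Ct)^'])
  end.

(* All the limits involved in D^k F(x)[h_1, ..., h_k] exist. *)
Fixpoint nc_derivable (F : op_tuple -> bop H) (k : nat) :
    ('I_k -> op_tuple) -> op_tuple -> Prop :=
  match k with
  | 0 => fun _ _ => True
  | k'.+1 => fun h x =>
      let h' := h \o widen_ord (leqnSn k') in
      (\forall l \near (0 : Ct), nc_derivable F h' (x + l *: h ord_max)) /\
      cvg (diff_quotient (nc_derive F h') x (h ord_max) l @[l --> (0 : Ct)^'])
  end.

End NCFunctions.

Notation free_poly R I := (malg (fmonom I) R[i]).

Section FreePolynomials.
Variables (R : realType) (H : hilbertType R) (I : choiceType).

Definition free_eval (p : free_poly R I) (x : I -> bop H) : bop H :=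
  \sum_(w <- msupp p) mcoeff w p *: \prod_(v <- fmonom_val w) x v.

Definition homogeneous (k : nat) (p : free_poly R I) : Prop :=
  forall w, w \in msupp p -> fdeg w = k.

End FreePolynomials.

(* The variable (i, r) stands for h_i^r. *)
Definition permute_vars k d (s : 'S_k) (w : fmonom ('I_k * 'I_d)%type) :
    fmonom ('I_k * 'I_d)%type :=
  FMonom [seq (s v.1, v.2) | v <- fmonom_val w].

Definition symmetric_poly (R : realType) k d
    (p : free_poly R ('I_k * 'I_d)%type) : Prop :=
  forall (s : 'S_k) w, mcoeff (permute_vars s w) p = mcoeff w p.

(* Main.v *)
(* For an NC function, conjugating the block matrix [[x + l h, t h], [0, x]]
   by [[1, t / l], [0, 1]] shows that its image has upper right corner
   (t / l) (F (x + l h) - F x); local boundedness then gives continuity, and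
   continuity gives the derivative as the corner of F [[x, t h], [0, x]].
   Iterating, D^k F (a) [h_1, ..., h_k] is a corner of F (a + Y) with Y jointly
   nilpotent.  At a scalar point such a value is a polynomial in Y: the row of
   monomials in Y intertwines Y with the creation matrices on words, which have
   scalar entries, and F of a matrix with scalar entries has scalar entries,
   as these commute with every operator.  The coefficient of a word in D^k F (a)
   depends only on its coordinate indices, whence the symmetry. *)

From HB Require Import structures.
Require Import Defs.
From mathcomp Require Import all_boot all_order all_algebra all_fingroup.
From mathcomp Require Import finmap sesquilinear complex.
From mathcomp Require Import -(notations) monalg.
From mathcomp Require Import all_classical all_reals all_analysis.

Set Implicit Arguments.
Unset Strict Implicit.
Unset Printing Implicit Defensive.

Import Order.TTheory GRing.Theory Num.Theory.
Import numFieldNormedType.Exports.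

Local Open Scope ring_scope.

(** * Choosing one element of a list *)

Fixpoint picks (T : Type) (s : seq T) : seq (T * seq T) :=
  if s is x :: s' then (x, s') :: [seq (p.1, x :: p.2) | p <- picks s']
  else [::].

Lemma picks_map (T T' : Type) (f : T -> T') (s : seq T) :
  picks (map f s) = [seq (f p.1, map f p.2) | p <- picks s].
Proof. by elim: s => //= x s ->; rewrite -!map_comp. Qed.

Lemma picks_fst (T : Type) (s : seq T) : [seq p.1 | p <- picks s] = s.
Proof. by elim: s => //= x s IH; rewrite -map_comp /=; congr (_ :: _). Qed.

Lemma picks_perm (T : eqType) (s : seq T) p :
  p \in picks s -> perm_eq (p.1 :: p.2) s.
Proof.
elim: s p => //= x s IH p; rewrite inE => /orP[/eqP -> //|/mapP[q qs ->]] /=.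
by have /= -> := perm_catCA [:: q.1] [:: x] q.2; rewrite perm_cons IH.
Qed.

Lemma picks_uniq (T : eqType) (s : seq T) : uniq s -> uniq (picks s).
Proof. by rewrite -{1}(picks_fst s); apply: map_uniq. Qed.

(** * Derivatives of noncommutative monomials *)

Section MonomialDerivative.
Variables (B : pzRingType) (d : nat).
Implicit Types (Y h : 'I_d -> B) (w : seq 'I_d) (hs : seq ('I_d -> B)).

(* The derivative of the monomial [w] at [Y] in the directions [hs]: each
   direction replaces exactly one letter. *)
Fixpoint mder w Y hs : B :=
  if w is r :: w' then
    Y r * mder w' Y hs + \sum_(p <- picks hs) p.1 r * mder w' Y p.2
  else (nilp hs)%:R.

Lemma mder_nil w Y : mder w Y [::] = \prod_(r <- w) Y r.
Proof.
elim: w => [|r w IH] /=; first by rewrite big_nil.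
by rewrite big_nil addr0 big_cons IH.
Qed.

(* In block form, the point of the left-hand side is [[Y, h], [0, Y]]. *)
Lemma mder_block (j : {rmorphism B -> B}) (N : B) w Y h hs :
  (forall x, N * j x = j x * N) -> N * N = 0 ->
  mder w (fun r => j (Y r) + N * j (h r)) [seq (fun r => j (g r)) | g <- hs] =
  j (mder w Y hs) + N * j (mder w Y (h :: hs)).
Proof.
move=> Nj NN; elim: w hs => [|r w IH] hs /=.
  by rewrite !rmorph0 mulr0 addr0; case: hs => /= *; rewrite ?rmorph1 ?rmorph0.
(* Two corner terms multiply to zero, so a product carries [h] in at most one letter. *)
have NjN x y : N * j x * (N * j y) = 0.
  by rewrite Nj -mulrA (mulrA N) NN mul0r mulr0.
rewrite picks_map !big_cons !big_map /= IH.
under eq_bigr do rewrite IH mulrDr mulrA -Nj -mulrA -!rmorphM.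
rewrite big_split /= -mulr_sumr -!rmorph_sum /=.
rewrite mulrDl !mulrDr NjN addr0 (mulrA _ N) -Nj -!mulrA -!rmorphM.
rewrite !rmorphD !mulrDr /=.
by rewrite -!addrA; congr (_ + _); rewrite [X in _ + X = _]addrCA [LHS]addrCA.
Qed.

End MonomialDerivative.

(** * Labelling the letters of a word *)

Section Labellings.
Variables (I L : eqType).
Implicit Types (w : seq L) (s : seq I) (v : seq (I * L)).

(** Each entry of [s] labels exactly one letter; the empty word has one labelling when no label is
    left over and none otherwise. *)
Fixpoint labellings w s : seq (seq (I * L)) :=
  if w is r :: w' then
    [seq (p.1, r) :: v | p <- picks s, v <- labellings w' p.2]
  else nseq (nilp s) [::].

(** Letters and labels are tested separately, so permuting the labels does not disturb the condition
    on the letters. *)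
Lemma mem_labellings w s v : uniq s ->
  (v \in labellings w s) = (unzip2 v == w) && perm_eq (unzip1 v) s.
Proof.
elim: w s v => [|r w IH] s v us /=.
  rewrite mem_nseq; case: s us => [|i s] _; case: v => [|x v] //=.
  by symmetry; apply/negP => /perm_size.
apply/idP/andP => [/allpairsPdep[p [v' [ps v'p ->]]]|].
  have /andP[_ up] : uniq (p.1 :: p.2) by rewrite (perm_uniq (picks_perm ps)).
  move: v'p; rewrite IH //= => /andP[/eqP -> pv].
  by rewrite eqxx -(permPr (picks_perm ps)) perm_cons.
case: v => [[]//|[i l] v] /= [/eqP[-> wE] vs].
have : i \in [seq p.1 | p <- picks s].
  by rewrite picks_fst -(perm_mem vs) inE eqxx.
move=> /mapP[p ps /= ip].
apply/allpairsPdep; exists p, v; split => //; last by rewrite ip.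
have := picks_perm ps; rewrite -(permPr vs) -ip perm_cons perm_sym => pv.
have /andP[_ up] : uniq (p.1 :: p.2) by rewrite (perm_uniq (picks_perm ps)).
by rewrite IH // wE eqxx.
Qed.

Lemma labellings_uniq w s : uniq s -> uniq (labellings w s).
Proof.
elim: w s => [|r w IH] s us /=; first by case: nilp.
apply: allpairs_uniq_dep => [|p ps|]; first exact: picks_uniq.
  have /andP[_ up] : uniq (p.1 :: p.2) by rewrite (perm_uniq (picks_perm ps)).
  by rewrite IH.
move=> [p v] [p' v'] /allpairsPdep[q [x [qs _ [-> ->]]]].
move=> /allpairsPdep[q' [x' [qs' _ [-> ->]]]] /= [qq ->].
suff -> : q = q' by [].
(* As [s] is duplicate-free, the first label determines the position in [picks s], hence the whole
   entry. *)
have U : uniq [seq p.1 | p <- picks s] by rewrite picks_fst.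
have := @uniqP _ q.1 _ U; move/(_ (index q (picks s)) (index q' (picks s))).
rewrite !inE !size_map !index_mem => /(_ qs qs').
rewrite !(nth_map q) ?index_mem // !nth_index // => /(_ qq) ii.
by rewrite -(nth_index q qs) ii nth_index.
Qed.

End Labellings.

(** At zero only the terms survive in which every letter is replaced by a direction; a labelling
    records which direction goes where. *)
Lemma mder0 (B : pzRingType) (d : nat) (I : eqType) (h : I -> 'I_d -> B)
    (w : seq 'I_d) (s : seq I) :
  mder w (fun=> 0) (map h s) =
  \sum_(v <- labellings w s) \prod_(x <- v) h x.1 x.2.
Proof.
elim: w s => [|r w IH] s /=.
  by case: s => [|i s] /=; rewrite ?big_seq1 ?big_nil.
rewrite mul0r add0r picks_map big_map big_allpairs_dep /=.
apply: eq_bigr => p _; rewrite IH mulr_sumr.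
by apply: eq_bigr => v _; rewrite big_cons.
Qed.

(** * Words of bounded length *)

Section WordList.
Variable d : nat.

(* Longer words come first, so that prepending a letter decreases the index. *)
Definition words (m : nat) : seq (seq 'I_d) :=
  sort (fun u v => size v <= size u)%N [seq val u | u <- enum {: m.-bseq 'I_d}].

Lemma words_uniq m : uniq (words m).
Proof. by rewrite sort_uniq map_inj_uniq ?enum_uniq //; apply: val_inj. Qed.

Lemma mem_words m (w : seq 'I_d) : (w \in words m) = (size w <= m)%N.
Proof.
rewrite mem_sort; apply/mapP/idP => [[u _ ->]|wm]; first exact: size_bseq.
by exists (Bseq wm); rewrite ?mem_enum.
Qed.

(** This order will make the creation matrices upper triangular. *)
Lemma index_words m (u v : seq 'I_d) : u \in words m -> v \in words m ->
  (size v < size u)%N -> (index u (words m) < index v (words m))%N.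
Proof.
move=> um vm; apply: contraTT; rewrite -!leqNgt => le.
apply: (sorted_leq_index (leT := fun u v => size v <= size u)%N) le => //.
  by move=> x y z xy yz; apply: leq_trans yz xy.
by apply: sort_sorted => x y; apply: leq_total.
Qed.

End WordList.

(** * Free polynomials with prescribed words *)

Section FreeEvaluation.
Variables (R : realType) (H : hilbertType R) (I : choiceType).
Variables (c : seq I -> R[i]) (L : seq (seq I)).

Definition poly_of_words : free_poly R I :=
  \sum_(v <- L) mkmalgU (FMonom v) (c v).

Hypothesis uL : uniq L.

Lemma mcoeff_poly_of_words w :
  mcoeff w poly_of_words = if fmonom_val w \in L then c (fmonom_val w) else 0.
Proof.
rewrite raddf_sum /=.
under eq_bigr do rewrite mcoeffU fmP /= mulrb.
rewrite -big_mkcond /=; case: ifP => wL.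
  rewrite (big_rem _ wL) /= eqxx big_seq_cond big1 ?addr0 // => v.
  by rewrite mem_rem_uniq // !inE => /andP[/andP[/negPf ->]].
by rewrite big_seq_cond big1 // => v /andP[vL /eqP vw]; rewrite -vw vL in wL.
Qed.

Lemma free_eval_poly_of_words (x : I -> bop H) :
  free_eval poly_of_words x = \sum_(v <- L) c v *: \prod_(i <- v) x i.
Proof.
rewrite /free_eval.
(* [c] may vanish on some words of [L], so the support consists of those with nonzero
   coefficient. *)
pose s := [seq w <- map (@FMonom I) L | mcoeff w poly_of_words != 0].
have ps : perm_eq (msupp poly_of_words) s.
  apply: uniq_perm; rewrite ?fset_uniq //.
    by rewrite filter_uniq // map_inj_uniq // => u v [].
  move=> w; rewrite mem_filter -mcoeff_neq0.
  case: eqVneq => //= w0; symmetry; apply/mapP.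
  exists (fmonom_val w); last by case: w w0.
  by move: w0; rewrite mcoeff_poly_of_words; case: ifP; rewrite ?eqxx.
rewrite (perm_big _ ps) /= big_filter big_map big_mkcond /=.
rewrite big_seq [RHS]big_seq; apply: eq_bigr => v vL.
by rewrite mcoeff_poly_of_words /= vL; case: eqP => //= ->; rewrite scale0r.
Qed.

End FreeEvaluation.

(** * Operator products and scalar operators *)

Section Operators.
Variables (R : realType) (H : hilbertType R).
Implicit Types (S T : bop H).

Lemma bop_normM S T : `|S * T| <= `|S| * `|T|.
Proof.
apply: opnorm_le => x x1; rewrite bopME (le_trans (opnormP _ _)) //.
rewrite ler_wpM2l ?opnorm_ge0 // (le_trans (opnormP _ _)) //.
by rewrite ler_piMr ?opnorm_ge0.
Qed.

Lemma bop_sumE (I : Type) (s : seq I) (P : pred I) (f : I -> bop H) x :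
  (\sum_(i <- s | P i) f i) x = \sum_(i <- s | P i) f i x.
Proof. by elim/big_rec2: _ => // i y z _ <-. Qed.

Lemma bop_sandwich_cvg (X : Type) (D : set_system X) {FD : Filter D}
    (f : X -> bop H) (S T L : bop H) :
  (f @ D --> L)%classic -> ((fun x => S * f x * T) @ D --> S * L * T)%classic.
Proof.
move=> fL; apply/cvgrPdist_lt => e e0.
(* The summand 1 keeps the divisor positive when [S] or [T] is zero. *)
have p0 : 0 < `|S| * `|T| + 1 by rewrite ltr_wpDl ?mulr_ge0.
have /cvgrPdist_lt/(_ (e / (`|S| * `|T| + 1)))-/(_ (divr_gt0 e0 p0)) := fL.
apply: filterS => x xe; rewrite -mulrBl -mulrBr.
apply: le_lt_trans (bop_normM _ _) _.
apply: le_lt_trans (ler_wpM2r (normr_ge0 _) (bop_normM _ _)) _.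
rewrite mulrAC; move: xe; rewrite ltr_pdivlMr // mulrC.
by apply: le_lt_trans; rewrite ler_wpM2r // lerDl.
Qed.

(** [T] commutes with each rank-one operator sending [x] to [f x *: u], where [f v = 1]; evaluating
    at [v] gives [T u = f (T v) *: u]. *)
Lemma bop_commute_scalar (v : H) T : v != 0 ->
  (forall S, S * T = T * S) -> exists c : R[i], T = c *: (1 : bop H).
Proof.
move=> v0 TC.
have vv0 : inner v v != 0 by rewrite -inner_norm expf_neq0 // normr_eq0.
pose f x := inner x v / inner v v.
have fl a x y : f (a *: x + y) = a * f x + f y.
  by rewrite /f linearPl mulrDl mulrA.
(* [f x *: v] is the orthogonal projection of [x] onto the line of [v], so Pythagoras bounds it by
   [x]. *)
have fb x : `|f x| <= `|v|^-1 * `|x|.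
  have nv : 0 < `|v| by rewrite normr_gt0.
  rewrite mulrC ler_pdivlMr // -normrZ.
  rewrite -(@ler_pXn2r _ 2) ?nnegrE //.
  have y0 : inner (x - f x *: v) v = 0.
    by rewrite linearBl linearZl /= /f mulrVK ?subrr // unitfE.
  have x2 : `|x| ^+ 2 = `|f x *: v| ^+ 2 + `|x - f x *: v| ^+ 2.
    rewrite !inner_norm -hnormDd ?[_ *: v + _]addrC ?subrK //.
    by rewrite linearZl_LR /= hermC [X in _ * (_ * _ X)]y0 rmorph0 !mulr0.
  by rewrite x2 lerDl exprn_ge0.
pose P (u x : H) := f x *: u.
have Pb u : P u \in @bounded_linear R H.
  apply/bounded_linearP; split=> [a x y|].
    by rewrite /P fl scalerDl scalerA.
  exists (`|v|^-1 * `|u|) => x.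
  by rewrite normrZ mulrAC ler_wpM2r.
exists (f (T v)); apply: bopP => u.
have /(congr1 (fun S => S v)) := TC (Bop (Pb u)).
rewrite bopZE bop1E !bopME /= /P => ->.
by rewrite /f divff // scale1r.
Qed.

End Operators.

(** * Block coordinates of a direct sum *)

Section Blocks.
Variables (R : realType) (H : hilbertType R) (n : nat) (U : unitary H n).

Let norm_sq f : `|U f| ^+ 2 = \sum_i `|f i| ^+ 2.
Proof.
by rewrite inner_norm unitary_inner; apply: eq_bigr => i _; rewrite inner_norm.
Qed.

Definition single (i : 'I_n) (v : H) : 'I_n -> H :=
  fun k => if k == i then v else 0.

Fact inj_op_subproof i : (fun v => U (single i v)) \in @bounded_linear R H.
Proof.
apply/bounded_linearP; split=> [a x y|].
  rewrite -unitary_linear; congr (U _); apply/funext => k.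
  by rewrite !fctE /single; case: ifP; rewrite ?scaler0 ?addr0.
exists 1 => x; rewrite mul1r -(@ler_pXn2r _ 2) ?nnegrE // norm_sq.
rewrite (bigD1 i) //= big1 ?addr0 /single ?eqxx // => k /negPf ->.
by rewrite normr0 expr0n.
Qed.
(** The embedding of the i-th summand, carried to H by [U]. With the coordinate maps [prj_op] it
    turns block matrices into sums of products in [bop H]. *)
Definition inj_op i : bop H := Bop (inj_op_subproof i).

Fact prj_op_subproof i : (fun v => unitary_inv U v i) \in @bounded_linear R H.
Proof.
apply/bounded_linearP; split=> [a x y|].
  rewrite -[x in LHS](unitary_invK U) -[y in LHS](unitary_invK U).
  by rewrite -unitary_linear unitary_funK.
exists 1 => x; rewrite mul1r -(@ler_pXn2r _ 2) ?nnegrE //.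
rewrite -[x in leRHS](unitary_invK U) norm_sq (bigD1 i) //= lerDl.
by apply: sumr_ge0 => k _; rewrite exprn_ge0.
Qed.
Definition prj_op i : bop H := Bop (prj_op_subproof i).

Lemma prj_inj i k : prj_op i * inj_op k = (i == k)%:R.
Proof.
apply: bopP => v; rewrite bopME /= unitary_funK /single.
by case: eqP => _; rewrite ?mulr1n ?mulr0n.
Qed.

Let sum_single f : U f = \sum_i U (single i (f i)).
Proof.
pose V : {linear ('I_n -> H) -> H} := HB.pack (U : _ -> _)
  (GRing.isLinear.Build R[i] ('I_n -> H) H _ U (unitary_linear U)).
rewrite -[RHS](linear_sum V) /=; congr (U _); apply/funext => k.
rewrite fct_sumE (bigD1 k) //= /single eqxx big1 ?addr0 // => i.
by rewrite eq_sym => /negPf ->.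
Qed.

Lemma sum_inj_prj : \sum_i inj_op i * prj_op i = 1.
Proof.
apply: bopP => v; rewrite bop_sumE bop1E -[RHS](unitary_invK U) sum_single.
by [].
Qed.

Lemma unitary_conjE (T : 'M[bop H]_n) :
  unitary_conj U T = \sum_i \sum_k inj_op i * T i k * prj_op k.
Proof.
apply: bopP => v; rewrite bop_sumE /= sum_single; apply: eq_bigr => i _.
rewrite bop_sumE /mxop -[LHS]/(inj_op i _) linear_sum /=.
by apply: eq_bigr.
Qed.

End Blocks.

(** * Upper triangular two-by-two blocks *)

Section Doubling.
Variables (R : realType) (H : hilbertType R) (V : unitary H 2).
Implicit Types (S T : bop H).

Local Notation J0 := (inj_op V ord0).
Local Notation J1 := (inj_op V ord_max).
Local Notation K0 := (prj_op V ord0).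
Local Notation K1 := (prj_op V ord_max).

(* The block matrix [[y, h], [0, x]]. *)
Definition upper y h x : bop H := J0 * y * K0 + J0 * h * K1 + J1 * x * K1.

(** [double] and multiples of [shift] will play the roles of [j] and [N] in [mder_block]. *)
Definition double T : bop H := upper T 0 T.
Definition shift : bop H := upper 0 1 0.
Definition corner S : bop H := K0 * S * J1.

Let KJ := (prj_inj V).

Lemma upper_inj0 y h x : upper y h x * J0 = J0 * y.
Proof. by rewrite /upper !mulrDl -!mulrA !KJ /= !mulr0 !addr0 mulr1. Qed.

Lemma upper_inj1 y h x : upper y h x * J1 = J0 * h + J1 * x.
Proof. by rewrite /upper !mulrDl -!mulrA !KJ /= !mulr0 add0r !mulr1. Qed.

Lemma upperM y h x y' h' x' :
  upper y h x * upper y' h' x' = upper (y * y') (y * h' + h * x') (x * x').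
Proof.
rewrite {2}/upper !mulrDr !mulrA upper_inj0 upper_inj1 !mulrDl.
by rewrite /upper !mulrDr !mulrDl !mulrA !addrA.
Qed.

Lemma upperD y h x y' h' x' :
  upper y h x + upper y' h' x' = upper (y + y') (h + h') (x + x').
Proof.
rewrite /upper !mulrDr !mulrDl -!addrA; congr (_ + _).
rewrite [X in _ + X = _]addrCA [LHS]addrCA; do 2!congr (_ + _).
by rewrite addrCA.
Qed.

Lemma upperZ (c : R[i]) y h x :
  c *: upper y h x = upper (c *: y) (c *: h) (c *: x).
Proof. by rewrite /upper !scalerDr -!bop_scalerAr -!bop_scalerAl. Qed.

Lemma upper1 : upper 1 0 1 = 1.
Proof.
rewrite /upper !mulr1 mulr0 mul0r addr0 -(sum_inj_prj V).
rewrite big_ord_recl big_ord1 /=.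
by have -> : lift ord0 ord0 = ord_max :> 'I_2 by apply: val_inj.
Qed.

Lemma corner_upper y h x : corner (upper y h x) = h.
Proof.
by rewrite /corner -mulrA upper_inj1 mulrDr !mulrA !KJ mul0r addr0 mul1r.
Qed.

Fact double_is_zmod_morphism : zmod_morphism double.
Proof.
move=> S T; rewrite /double -[- upper T 0 T]scaleN1r upperZ upperD.
by rewrite !scaleN1r subrr.
Qed.

Fact double_is_monoid_morphism : monoid_morphism double.
Proof.
split=> [|S T]; first exact: upper1.
by rewrite /double upperM mulr0 mul0r addr0.
Qed.

HB.instance Definition _ :=
  GRing.isZmodMorphism.Build (bop H) (bop H) double double_is_zmod_morphism.
HB.instance Definition _ :=
  GRing.isMonoidMorphism.Build (bop H) (bop H) double double_is_monoid_morphism.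

Lemma doubleZ (c : R[i]) T : double (c *: T) = c *: double T.
Proof. by rewrite /double upperZ scaler0. Qed.

Lemma shift_double T : shift * double T = upper 0 T 0.
Proof. by rewrite /shift upperM !mul0r mul1r add0r. Qed.

Lemma shift_doubleC T : shift * double T = double T * shift.
Proof. by rewrite shift_double /shift upperM !mulr0 mulr1 addr0. Qed.

Lemma shiftK : shift * shift = 0.
Proof.
by rewrite /shift upperM !mul0r mulr0 addr0 /upper !(mulr0, mul0r) !addr0.
Qed.

Lemma corner_sandwich (c : R[i]) T :
  c *: corner T = (c *: K0) * T * J1.
Proof. by rewrite /corner -!bop_scalerAl. Qed.

Lemma cornerZ (c : R[i]) T : corner (c *: T) = c *: corner T.
Proof. by rewrite /corner -bop_scalerAr -bop_scalerAl. Qed.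

Lemma unitary_conj_upper (T : 'M[bop H]_2) : T ord_max ord0 = 0 ->
  unitary_conj V T = upper (T ord0 ord0) (T ord0 ord_max) (T ord_max ord_max).
Proof.
move=> T0; rewrite unitary_conjE !big_ord_recl !big_ord0 !addr0.
have -> : lift ord0 ord0 = ord_max :> 'I_2 by apply: val_inj.
by rewrite T0 mulr0 mul0r add0r.
Qed.

End Doubling.

(** * Continuity and derivatives of NC functions *)

Section NCFunctions.
Variables (R : realType) (H : hilbertType R) (d : nat).
Local Notation C := R[i].
Local Notation Ct := (R[i] : numFieldType).
Local Notation op_tuple := ('I_d -> bop H).
Variables (A : set (bop H)) (U : forall n : nat, unitary H n.+1).
Hypotheses (hA : unital_closed_subalgebra A) (hU : direct_sum_property A U).
Variables (Omega : set op_tuple) (hOmega : nc_domain A U Omega).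
Variables (F : op_tuple -> bop H) (hF : nc_function Omega F).
Implicit Types (x y h g : op_tuple) (l t : C).

Local Notation V := (U 1).

Let A0 : A 0.
Proof.
have := subalg_linear hA (-1) (subalg_one hA) (subalg_one hA).
by rewrite scaleN1r addNr.
Qed.

Lemma upper_in (y h x : bop H) : A y -> A h -> A x -> A (upper V y h x).
Proof.
move=> Ay Ah Ax.
pose T : 'M[bop H]_2 := \matrix_(i, k)
  if (i == ord0) && (k == ord0) then y else
  if k == ord0 then 0 else if i == ord0 then h else x.
have -> : upper V y h x = unitary_conj V T.
  by rewrite unitary_conj_upper !mxE.
apply: hU => i k; rewrite mxE; first by do ?case: ifP.
by case: i => -[|[|//]] ?; case: k => -[|[|//]].
Qed.

Lemma near_line x g : Omega x -> tuples_in A g ->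
  exists M : C, \forall l \near (0 : Ct), Omega (x + l *: g) /\
    `|F (x + l *: g)| <= M.
Proof.
move=> Ox Ag.
have [e e0 Oe] := nc_domain_open hOmega Ox.
have [e' e'0 [M FM]] := nc_locally_bounded hF Ox.
(* [G] is positive and dominates every coordinate of [g], so the radius [b / G] serves all
   coordinates at once. *)
pose G := 1 + \sum_r `|g r|.
have G0 : 0 < G by rewrite ltr_pwDl ?sumr_ge0.
have small (b : C) : 0 < b -> \forall l \near (0 : Ct),
    forall r, `|(x + l *: g) r - x r| < b.
  move=> b0; apply/nbhs_ballP; exists (b / G); first exact: divr_gt0.
  move=> l; rewrite /ball /= sub0r normrN ltr_pdivlMr // => lb r.
  rewrite [X in X - _](_ : _ = x r + l *: g r) // addrC addKr normrZ.
  apply: le_lt_trans lb; rewrite ler_wpM2l // /G (bigD1 r) //=.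
  by rewrite addrCA lerDl addr_ge0 ?sumr_ge0.
exists M; near=> l.
have xO : Omega (x + l *: g).
  apply: Oe; last by near: l; exact: small.
  move=> r; have -> : (x + l *: g) r = l *: g r + x r by apply: addrC.
  by apply: (subalg_linear hA) => //; exact: (nc_domain_sub hOmega Ox).
by split=> //; apply: FM => //; near: l; exact: small.
Unshelve. all: by end_near. Qed.

Lemma near0_neq0 (P : C -> Prop) :
  (\forall l \near (0 : Ct), P l) -> exists2 t, t != 0 & P t.
Proof.
move=> /nbhs_ballP[e e0 eP]; exists (e / 2).
  by rewrite mulf_neq0 ?gt_eqF ?invr_gt0.
apply: eP; rewrite /ball /= sub0r normrN ger0_norm ?ltW ?divr_gt0 //.
by rewrite ltr_pdivrMr // ltr_pMr // ltr1n.
Qed.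

Definition block y h x : op_tuple := fun r => upper V (y r) (h r) (x r).

Lemma block_in y h x : tuples_in A y -> tuples_in A h -> tuples_in A x ->
  tuples_in A (block y h x).
Proof. by move=> Ay Ah Ax r; apply: upper_in. Qed.

Lemma blockDZ y h x y' h' x' l :
  block y h x + l *: block y' h' x' =
  block (y + l *: y') (h + l *: h') (x + l *: x').
Proof.
apply/funext => r.
rewrite -[LHS]/(upper V _ _ _ + l *: upper V _ _ _) upperZ.
exact: upperD.
Qed.

Lemma block_double x : Omega x -> Omega (block x 0 x).
Proof.
move=> Ox.
(* Here [n := 0] stands for two summands. *)
have := nc_domain_direct_sum hOmega (n := 0) (x := fun=> x) (fun=> Ox).
have -> // : direct_sum V (fun=> x) = block x 0 x.
by apply/funext => r; rewrite /direct_sum unitary_conj_upper !mxE.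
Qed.

Let in0 : tuples_in A (0 : op_tuple). Proof. by move=> r; apply: A0. Qed.

(** [J0] intertwines [y] with the block, and [t *: J0 - l *: J1] intertwines [x] with it because the
    terms in [g] cancel. Nothing is divided by, so [l = 0] is covered. *)
Lemma corner_block x y h g l t :
  Omega x -> Omega y -> Omega (block y h x) ->
  y = x + l *: g -> h = t *: g ->
  t *: (F y - F x) = l *: corner V (F (block y h x)).
Proof.
move=> Ox Oy Oz yE hE.
set J0 := inj_op V ord0; set J1 := inj_op V ord_max; set K0 := prj_op V ord0.
have FJ0 : J0 * F y = F (block y h x) * J0.
  by apply: (nc_intertwining hF) => // r; rewrite /block upper_inj0.
have comm r :
    (t *: J0 - l *: J1) * x r = block y h x r * (t *: J0 - l *: J1).
  rewrite /block mulrBr -!bop_scalerAr upper_inj0 upper_inj1.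
  rewrite mulrBl -!bop_scalerAl scalerDr opprD addrA; congr (_ - _).
  have -> : y r = x r + l *: g r by rewrite yE.
  have -> : h r = t *: g r by rewrite hE.
  rewrite mulrDr scalerDr -!bop_scalerAr !scalerA (mulrC t).
  by rewrite addrK.
have /(congr1 (fun S => K0 * S)) := nc_intertwining hF Ox Oz comm.
rewrite mulrBl mulrBr mulrBr -!bop_scalerAr -!bop_scalerAl -FJ0.
rewrite mulrBr -!bop_scalerAr !mulrA !prj_inj /= mul0r !mul1r scaler0 subr0.
by rewrite /corner => E; rewrite scalerBr E opprB addrC subrK.
Qed.

(** The double of [x] lies in the relatively open [Omega], so a small corner may be added; the
    factor [t] is divided out later. *)
Lemma block_near x h : Omega x -> tuples_in A h ->
  exists2 t, t != 0 & Omega (block x (t *: h) x).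
Proof.
move=> Ox Ah.
have [_ /near0_neq0[t t0 [Ot _]]] :=
  near_line (block_double Ox) (block_in in0 Ah in0).
by exists t => //; move: Ot; rewrite blockDZ !scaler0 addr0 add0r.
Qed.

(** By [corner_block] the increment of [F] is [l / s] times a corner of [F] at a nearby block, and
    this corner stays bounded. *)
Lemma nc_line_continuous x g : Omega x -> tuples_in A g ->
  (F (x + l *: g) @[l --> (0 : Ct)^'] --> F x)%classic.
Proof.
move=> Ox Ag; have [s s0 OE] := block_near Ox Ag.
have [M nM] := near_line OE (block_in Ag in0 in0).
have [MO nO] := near_line Ox Ag.
have M0 : 0 <= M by have [_] := nbhs_singleton nM; apply: le_trans.
(* [B] exceeds the bound for [s^-1] times that corner; the summand 1 makes it positive. *)
pose B := `|s|^-1 * (`|prj_op V ord0| * M * `|inj_op V ord_max|) + 1.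
have B0 : 0 < B by rewrite ltr_wpDl ?mulr_ge0 ?invr_ge0.
apply/cvgrPdist_lt => e e0; apply: nbhs_dnbhs.
near=> l.
have [Ol _] : Omega (x + l *: g) /\ `|F (x + l *: g)| <= MO by near: l.
have [OB FB] : Omega (block x (s *: g) x + l *: block g 0 0) /\
  `|F (block x (s *: g) x + l *: block g 0 0)| <= M by near: l.
move: OB FB; rewrite blockDZ !scaler0 !addr0 => OB FB.
have := corner_block Ox Ol OB erefl erefl.
move/(congr1 (fun S => s^-1 *: S)); rewrite scalerA mulVf // scale1r => E.
have lB : `|l| < e / B.
  near: l; apply/nbhs_ballP; exists (e / B); first exact: divr_gt0.
  by move=> l; rewrite /ball /= sub0r normrN.
rewrite distrC E scalerA normrZ normrM normfV.
move: lB; rewrite ltr_pdivlMr //; apply: le_lt_trans.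
rewrite mulrAC mulrC ler_wpM2l // ler_wpDr // ler_wpM2l ?invr_ge0 //.
apply: le_trans (bop_normM _ _) _; rewrite ler_wpM2r //.
by apply: le_trans (bop_normM _ _) _; rewrite ler_wpM2l.
Unshelve. all: by end_near. Qed.

(** The difference quotient is [t^-1] times the corner of [F] at a block moving along a line, so
    continuity along that line gives the limit. *)
Lemma nc_first_derivative x h t : Omega x -> tuples_in A h -> t != 0 ->
  Omega (block x (t *: h) x) ->
  (diff_quotient F x h l @[l --> (0 : Ct)^'] -->
   t^-1 *: corner V (F (block x (t *: h) x)))%classic.
Proof.
move=> Ox Ah t0 OE.
rewrite corner_sandwich; apply: cvg_trans (bop_sandwich_cvg
  (nc_line_continuous OE (block_in Ah in0 in0))).
apply: near_eq_cvg.
have [MO nO] := near_line Ox Ah.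
have [ME nE] := near_line OE (block_in Ah in0 in0).
near=> l.
have l0 : l != 0 by near: l; exact: (@nbhs_dnbhs_neq Ct 0).
have [Ol _] : Omega (x + l *: h) /\ `|F (x + l *: h)| <= MO.
  by near: l; apply: nbhs_dnbhs nO.
have [OB _] : Omega (block x (t *: h) x + l *: block h 0 0) /\
  `|F (block x (t *: h) x + l *: block h 0 0)| <= ME.
  by near: l; apply: nbhs_dnbhs nE.
move: OB; rewrite blockDZ !scaler0 !addr0 => OB.
have := corner_block Ox Ol OB erefl erefl.
move/(congr1 (fun S => (t^-1 * l^-1) *: S)).
rewrite scalerA mulrAC mulVf // mul1r /diff_quotient => ->.
by rewrite scalerA mulrVK ?unitfE // -!bop_scalerAl.
Unshelve. all: by end_near. Qed.

Let bop_cvg_lim (f : C -> bop H) (L : bop H) :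
  (f l @[l --> (0 : Ct)^'] --> L)%classic ->
  lim (f l @[l --> (0 : Ct)^'])%classic = L.
Proof. by move=> fL; apply: cvg_lim fL; apply: (@norm_hausdorff _ (bop H)). Qed.

(** The first direction sits in the corner while the last one is differentiated on both diagonal
    places. Derivability is proved jointly: the limit at the block exists by the induction
    hypothesis there, with one direction fewer, and taking corners preserves limits. *)
Lemma nc_derive_block k (h : 'I_k.+1 -> op_tuple) x t :
  (forall i, tuples_in A (h i)) -> Omega x -> t != 0 ->
  Omega (block x (t *: h ord0) x) ->
  nc_derivable F h x /\
  nc_derive F h x = t^-1 *: corner V (nc_derive F
    (fun i => block (h (lift ord0 i)) 0 (h (lift ord0 i)))
    (block x (t *: h ord0) x)).
Proof.
elim: k h x t => [|k IH] h x t Ah Ox t0 OE.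
  have e0 : ord_max = ord0 :> 'I_1 by apply: val_inj.
  have dF := nc_first_derivative Ox (Ah ord0) t0 OE.
  rewrite /= e0; split; last exact: bop_cvg_lim dF.
  split; last exact: cvgP dF.
  by near=> l.
set E := block x _ x in OE *.
pose h' := h \o widen_ord (leqnSn k.+1).
pose g i := block (h (lift ord0 i)) 0 (h (lift ord0 i)).
pose hm := h ord_max.
have Ah' i : tuples_in A (h' i) by exact: Ah.
have Ag i : tuples_in A (g i) by apply: block_in.
have h'0 : h' ord0 = h ord0 by congr h; apply: val_inj.
have gh' : g \o widen_ord (leqnSn k) =
    (fun i => block (h' (lift ord0 i)) 0 (h' (lift ord0 i))).
  apply/funext => i; rewrite /g /h' /=.
  by have -> : lift ord0 (widen_ord (leqnSn k) i) =
    widen_ord (leqnSn k.+1) (lift ord0 i) by apply: ord_inj.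
have gm : g ord_max = block hm 0 hm.
  rewrite /g.
  by have -> : lift ord0 ord_max = ord_max :> 'I_k.+2 by apply: ord_inj.
have IHd (f : 'I_k.+1 -> op_tuple) y : (forall i, tuples_in A (f i)) ->
    Omega y -> nc_derivable F f y.
  move=> Af Oy; have [s s0 Os] := block_near Oy (Af ord0).
  by have [] := IH f y s Af Oy s0 Os.
pose D := nc_derive F (g \o widen_ord (leqnSn k)).
have Fcvg : cvg (diff_quotient D E (g ord_max) l @[l --> (0 : Ct)^'])%classic.
  by have [] := IHd g E Ag OE.
have [MO nO] := near_line Ox (Ah ord_max).
have [ME nE] := near_line OE (Ag ord_max).
(* Moving along the doubled direction leaves the corner fixed, so the induction hypothesis applies
   at [x + l *: hm] with the same [t]. *)
have EE l : E + l *: g ord_max =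
    block (x + l *: hm) (t *: h' ord0) (x + l *: hm).
  by rewrite gm blockDZ scaler0 addr0 h'0.
have IHl : \forall l \near (0 : Ct), nc_derivable F h' (x + l *: hm) /\
    nc_derive F h' (x + l *: hm) =
      t^-1 *: corner V (D (E + l *: g ord_max)).
  near=> l.
  have [Ol _] : Omega (x + l *: hm) /\ `|F (x + l *: hm)| <= MO by near: l.
  have [Oe _] : Omega (E + l *: g ord_max) /\
    `|F (E + l *: g ord_max)| <= ME by near: l.
  by rewrite /D gh' EE; apply: IH => //; rewrite -EE.
have Fl : (diff_quotient (nc_derive F h') x hm l @[l --> (0 : Ct)^'] -->
    t^-1 *: corner V (lim (diff_quotient D E (g ord_max) l
      @[l --> (0 : Ct)^'])))%classic.
  rewrite corner_sandwich; apply: cvg_trans (bop_sandwich_cvg Fcvg).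
  apply: near_eq_cvg; near=> l; rewrite /diff_quotient.
  have [_ ->] : nc_derivable F h' (x + l *: hm) /\
    nc_derive F h' (x + l *: hm) =
      t^-1 *: corner V (D (E + l *: g ord_max)).
    by near: l; apply: nbhs_dnbhs IHl.
  (* The same identity at [l = 0], for the base point of the quotient. *)
  have [_] := nbhs_singleton IHl; rewrite !scale0r !addr0 => ->.
  by rewrite !corner_sandwich -mulrBl -mulrBr
    -bop_scalerAr -bop_scalerAl.
split; last exact: bop_cvg_lim Fl.
split; last exact: cvgP Fl.
by apply: filterS IHl => l [].
Unshelve. all: by end_near. Qed.

(** * Expansion at a scalar point *)

Variables (a : op_tuple) (Oa : Omega a) (sa : scalar_point a).
Variables (v : H) (v0 : v != 0).

Let aC r (T : bop H) : a r * T = T * a r.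
Proof.
by have [c ->] := sa; rewrite -bop_scalerAl -bop_scalerAr mul1r mulr1.
Qed.

(** The coefficients are read off from [F] at one fixed matrix indexed by words, so they do not
    depend on [Y]. *)
Lemma nilpotent_expansion m : exists c : seq 'I_d -> C, forall Y : op_tuple,
  (forall w : seq 'I_d, size w = m.+1 -> \prod_(r <- w) Y r = 0) ->
  Omega (a + Y) ->
  F (a + Y) = \sum_(w <- words d m) c w *: \prod_(r <- w) Y r.
Proof.
set W := words d m; pose n := (size W).-1.
have W0 : [::] \in W by rewrite mem_words.
have sW : size W = n.+1 by rewrite prednK //; case: (W) W0.
have WW (p : 'I_n.+1) : nth [::] W p \in W by rewrite mem_nth // sW.
have idxK w : w \in W -> nth [::] W (inord (index w W) : 'I_n.+1) = w.
  by move=> wW; rewrite inordK ?nth_index // -sW index_mem.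
have uW : uniq W by apply: words_uniq.
pose J := inj_op (U n); pose K := prj_op (U n).
pose b r (p q : 'I_n.+1) : bool := nth [::] W p == r :: nth [::] W q.
(* The creation matrix of [r], cut off at length [m]: it sends a word to the word with [r]
   prepended. *)
pose S r := unitary_conj (U n) (\matrix_(p, q) (b r p q)%:R).
have AS : tuples_in A S.
  move=> r; apply: hU => p q; rewrite mxE.
    by case: (b r p q); [exact: (subalg_one hA) | exact: A0].
  (* A nonzero entry has the longer word as its row, which comes earlier in the list, so it lies
     above the diagonal. *)
  case bpq: (b r p q) => // qp.
  have /eqP E := bpq; have := WW p; rewrite E => rW.
  have := index_words rW (WW q) (ltnSn _).
  by rewrite -E !index_uniq ?sW // ltnNge ltnW.
(* The factor [s] brings the point into [Omega]; its powers are divided out of the coefficients. *)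
have [_ /near0_neq0[s s0 [OS _]]] := near_line Oa AS.
set G := F (a + s *: S) in OS *.
pose q0 : 'I_n.+1 := inord (index [::] W).
have q0E : nth [::] W q0 = [::] by apply: idxK.
have /choice[e eP] : forall p, exists e : C, K p * G * J q0 = e *: (1 : bop H).
  move=> p; apply: (bop_commute_scalar v0) => T.
  (* [D] repeats [T] along the diagonal. It commutes with matrices of scalar entries, hence with
     [G], so [T] commutes with each entry of [G]. *)
  pose D := \sum_i J i * T * K i.
  have KD i : K i * D = T * K i.
    rewrite /D mulr_sumr (bigD1 i) //= big1 => [|k ki].
      by rewrite !mulrA prj_inj eqxx mul1r addr0.
    by rewrite !mulrA prj_inj eq_sym (negPf ki) !mul0r.
  have DJ i : D * J i = J i * T.
    rewrite /D mulr_suml (bigD1 i) //= big1 => [|k ki].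
      by rewrite -!mulrA prj_inj eqxx mulr1 addr0.
    by rewrite -!mulrA prj_inj (negPf ki) !mulr0.
  have DS r : D * (a + s *: S) r = (a + s *: S) r * D.
    rewrite -[(a + s *: S) r]/(a r + s *: S r) mulrDr mulrDl aC.
    rewrite -bop_scalerAr -bop_scalerAl; congr (_ + s *: _).
    rewrite /S unitary_conjE mulr_sumr mulr_suml; apply: eq_bigr => i _.
    rewrite mulr_sumr mulr_suml; apply: eq_bigr => k _.
    rewrite !mulrA DJ -(mulrA _ (K k)) KD mxE [RHS]mulrA.
    by congr (_ * K k); rewrite -!mulrA (commr_nat T).
  have DG := nc_intertwining hF OS OS DS.
  by rewrite !mulrA -KD -(mulrA (K p)) DG -!mulrA DJ.
exists (fun w => s ^- size w * e (inord (index w W))) => Y nY OY.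
pose y w := s ^- size w *: \prod_(r <- w) Y r.
pose L := \sum_(p < n.+1) y (nth [::] W p) * K p.
have LJ q : L * J q = y (nth [::] W q).
  rewrite /L mulr_suml (bigD1 q) //= big1 => [|p pq].
    by rewrite -!mulrA prj_inj eqxx mulr1 addr0.
  by rewrite -!mulrA prj_inj (negPf pq) !mulr0.
(* The row of rescaled monomials intertwines the creation matrices with [Y]. *)
have LS r : L * (a + s *: S) r = (a + Y) r * L.
  rewrite -[(a + s *: S) r]/(a r + s *: S r) -[(a + Y) r]/(a r + Y r).
  rewrite mulrDr mulrDl aC -bop_scalerAr; congr (_ + _).
  rewrite /S unitary_conjE mulr_sumr.
  under eq_bigr do rewrite mulr_sumr.
  rewrite exchange_big scaler_sumr /L mulr_sumr; apply: eq_bigr => q _.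
  under eq_bigr do rewrite !mulrA LJ mxE.
  rewrite -mulr_suml mulrA bop_scalerAl; congr (_ * _).
  have Yr w : Y r * y w = s *: y (r :: w).
    rewrite /y big_cons /= exprS invfM scalerA mulrA divff // mul1r.
    by rewrite -bop_scalerAr.
  rewrite Yr; congr (_ *: _).
  (* Either the extended word is listed and exactly one row contributes, or it has length [m.+1] and
     nilpotency makes both sides zero. *)
  have [rW|rW] := boolP (r :: nth [::] W q \in W).
    pose p0 : 'I_n.+1 := inord (index (r :: nth [::] W q) W).
    have p0E : nth [::] W p0 = r :: nth [::] W q by apply: idxK.
    rewrite (bigD1 p0) //= big1 => [|p pp]; rewrite /b.
      by rewrite p0E eqxx mulr1 addr0.
    by rewrite -p0E nth_uniq ?sW // val_eqE (negPf pp) mulr0.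
  rewrite big1 => [|p _].
    rewrite /y nY ?scaler0 //; apply/eqP; rewrite eqn_leq.
    by move: rW (WW q); rewrite !mem_words /= ltnS -ltnNge => -> ->.
  rewrite /b; case: eqP => [E|_]; last by rewrite mulr0.
  by rewrite -E WW in rW.
(* The column of the empty word suffices, since the row [L] has entry 1 there. *)
have -> : F (a + Y) = L * G * J q0.
  rewrite (nc_intertwining hF OS OY LS) -mulrA LJ q0E /y big_nil invr1.
  by rewrite scale1r mulr1.
rewrite (big_nth [::]) big_mkord sW /L -mulrA mulr_suml.
apply: eq_bigr => p _; rewrite -mulrA (mulrA (K p)) eP.
by rewrite index_uniq ?sW // inord_val -bop_scalerAr mulr1 scalerA mulrC.
Qed.

(** Each derivative moves to a block, which doubles the nilpotency order [n]; hence the bound with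
    [2 ^ k]. [mder_block] then reads the corner as a derivative of monomials. *)
Lemma derivative_expansion m (c : seq 'I_d -> C) :
  (forall Y : op_tuple,
    (forall w : seq 'I_d, size w = m.+1 -> \prod_(r <- w) Y r = 0) ->
    Omega (a + Y) ->
    F (a + Y) = \sum_(w <- words d m) c w *: \prod_(r <- w) Y r) ->
  forall k n (h : 'I_k -> op_tuple) Y, (forall i, tuples_in A (h i)) ->
    (forall w : seq 'I_d, size w = n -> \prod_(r <- w) Y r = 0) ->
    (n * 2 ^ k <= m.+1)%N -> Omega (a + Y) ->
    nc_derive F h (a + Y) =
    \sum_(w <- words d m) c w *: mder w Y [seq h i | i <- enum 'I_k].
Proof.
move=> FY; elim=> [|k IH] n h Y Ah nY nm OY.
  rewrite (size0nil (size_enum_ord 0)) /= FY // => [|w wm].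
    by apply: eq_bigr => w _; rewrite mder_nil.
  rewrite muln1 -wm in nm; rewrite -(cat_take_drop n w) big_cat /=.
  by rewrite nY ?mul0r // size_takel.
have [t t0 Ot] := block_near OY (Ah ord0).
have [_ ->] := nc_derive_block Ah OY t0 Ot.
pose N := t *: shift V.
have NC T : N * double V T = double V T * N.
  by rewrite /N -bop_scalerAl -bop_scalerAr shift_doubleC.
have NN : N * N = 0.
  by rewrite /N -bop_scalerAl -bop_scalerAr shiftK !scaler0.
pose Y' : op_tuple := fun r => double V (Y r) + N * double V (h ord0 r).
have EY : block (a + Y) (t *: h ord0) (a + Y) = a + Y'.
  apply/funext => r; rewrite /Y' -[RHS]/(a r + (_ + _)) addrA.
  (* Doubling fixes scalars, so the block is again a perturbation of the same point [a]. *)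
  have {1}<- : double V (a r) = a r.
    by have [ca ->] := sa; rewrite doubleZ rmorph1.
  by rewrite -rmorphD -bop_scalerAl shift_double upperZ upperD !scaler0
    !addr0 add0r.
rewrite EY in Ot *.
rewrite (IH (n + n)%N) //; first last.
- by rewrite addnn -muln2 -mulnA -expnS.
(* Each half of the word leaves only a corner term, and two corner terms multiply to zero. *)
- move=> w wn; rewrite -(cat_take_drop n w) big_cat /=.
  have Y'0 u : size u = n ->
      \prod_(r <- u) Y' r = N * double V (mder u Y [:: h ord0]).
    move=> un; rewrite -mder_nil.
    rewrite (mder_block (j := double V) u Y (h ord0) [::] NC NN).
    by rewrite mder_nil nY // rmorph0 add0r.
  rewrite !Y'0 ?size_drop ?wn ?addnK //; last first.
    by rewrite size_takel ?wn ?leq_addr.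
  by rewrite NC -mulrA (mulrA N) NN mul0r mulr0.
- by move=> i; apply: block_in.
rewrite enum_ordSl /= -map_comp.
have corner_sum (I : Type) (r : seq I) (f : I -> bop H) :
    corner V (\sum_(i <- r) f i) = \sum_(i <- r) corner V (f i).
  by rewrite /corner mulr_sumr mulr_suml.
rewrite corner_sum scaler_sumr; apply: eq_bigr => w _.
have := mder_block (j := double V) w Y (h ord0)
  [seq h (lift ord0 i) | i <- enum 'I_k] NC NN.
rewrite -map_comp => ->.
rewrite -bop_scalerAl shift_double -[_ *: upper _ _ _ _]/(_) upperZ upperD.
by rewrite cornerZ corner_upper add0r !scalerA mulrCA mulVf // mulr1.
Qed.

End NCFunctions.

(** * The derivative as a symmetric free polynomial *)

Theorem theorem1p9 (R : realType) (H : hilbertType R)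
    (infH : infinite_dimensional H)
    (A : set (bop H)) (U : forall n : nat, unitary H n.+1)
    (hA : unital_closed_subalgebra A) (hU : direct_sum_property A U)
    (d : nat) (hd : (0 < d)%N)
    (Omega : set (op_tuple H d)) (hOmega : nc_domain A U Omega)
    (a : op_tuple H d) (ha : Omega a) (sa : scalar_point a)
    (F : op_tuple H d -> bop H) (hF : nc_function Omega F)
    (k : nat) (hk : (1 <= k)%N) :
  exists p : free_poly R ('I_k * 'I_d)%type,
    [/\ homogeneous k p, symmetric_poly p &
      forall h : 'I_k -> op_tuple H d, (forall i, tuples_in A (h i)) ->
        nc_derivable F h a /\
        nc_derive F h a = free_eval p (fun v => h v.1 v.2)].
Proof.
(* The empty family does not span H, which yields a nonzero vector. *)
have [v vP] := infH 0 (fun=> 0).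
have v0 : v != 0.
  by apply/eqP => E; apply: (vP (fun=> 0)); rewrite big_ord0.
(* At [Y = 0] the nilpotency order is 1, and [k] doublings raise it to [2 ^ k]. *)
pose m := (2 ^ k)%N.
have [c cP] := nilpotent_expansion hA hU hOmega hF ha sa v0 m.
(* The words in which every direction index occurs exactly once, whence degree [k]. *)
pose L := [seq u | w <- words d m, u <- labellings w (enum 'I_k)].
have uk : uniq (enum 'I_k) by apply: enum_uniq.
have memL u : (u \in L) = (size u <= m)%N && perm_eq (unzip1 u) (enum 'I_k).
  apply/allpairsPdep/andP => [[w [u' [wm uw ->]]]|[um uE]].
    move: uw; rewrite mem_labellings // => /andP[/eqP uw ->].
    by move: wm; rewrite mem_words -uw size_map.
  exists (unzip2 u), u; rewrite mem_words size_map um.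
  by rewrite mem_labellings // eqxx uE.
have uL : uniq L.
  apply: allpairs_uniq_dep => [|w _|]; first exact: words_uniq.
    exact: labellings_uniq.
  move=> [w u] [w' u'] /allpairsPdep[x [y [_ xy [-> ->]]]].
  move=> /allpairsPdep[x' [y' [_ xy' [-> ->]]]] /= yy.
  move: xy xy'; rewrite !mem_labellings // yy => /andP[/eqP <- _].
  by move=> /andP[/eqP <- _].
(* The coefficient sees only the coordinate letters, so permuting the directions does not change
   it. *)
pose p := poly_of_words (R := R) (fun u => c (unzip2 u)) L.
have pE w : mcoeff w p = if fmonom_val w \in L then c (unzip2 w) else 0.
  exact: mcoeff_poly_of_words.
exists p; split=> [w|s w|h Ah].
- rewrite -mcoeff_neq0 pE memL; case: ifP => [/andP[_ /perm_size]|].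
    by rewrite size_map size_enum_ord.
  by rewrite eqxx.
- rewrite !pE !memL /= size_map /unzip1 /unzip2 -!map_comp /=.
  suff -> : perm_eq [seq (s v.1) | v <- w] (enum 'I_k) =
            perm_eq [seq v.1 | v <- w] (enum 'I_k) by [].
  have sE : perm_eq (map s (enum 'I_k)) (enum 'I_k).
    apply: uniq_perm => // [|i].
      by rewrite map_inj_uniq //; apply: perm_inj.
    rewrite mem_enum; apply/mapP; exists (s^-1%g i); rewrite ?mem_enum //.
    by rewrite permKV.
  rewrite -(permPr sE) (map_comp s fst).
  by apply/idP/idP; [apply: perm_map_inj; apply: perm_inj | apply: perm_map].
split.
  case: k hk h Ah {m c cP L uk memL uL p pE} => // k _ h Ah.
  have [t t0 Ot] := block_near hA hU hOmega hF ha (Ah ord0).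
  by have [] := nc_derive_block hA hU hOmega hF Ah ha t0 Ot.
have a0 : a + 0 = a by rewrite addr0.
have := derivative_expansion hA hU hOmega hF sa cP (n := 1) (Y := 0) Ah.
rewrite a0 => -> //; last by rewrite mul1n.
  rewrite free_eval_poly_of_words // big_allpairs_dep /=.
  apply: eq_bigr => w _; rewrite mder0 scaler_sumr.
  apply: eq_big_seq => u; rewrite mem_labellings // => /andP[/eqP <- _].
  by [].
by move=> [|r [|]] // _; rewrite big_seq1.
Qed.
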